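(* There is an algorithm that solves the single-capacity unbounded knapsack problem in $O(nu\log^2 u)$ time, where $n$ is the number of items and $u=\max_i w_i$.
   Context: Single-capacity unbounded knapsack: given $n$ items, item $i$ having a positive integer weight $w_i$ and a positive profit $p_i$, and a positive integer capacity $t$, compute the maximum of $\sum_{i=1}^n m_i p_i$ over all $m_1,\dots,m_n\in\mathbb{N}=\{0,1,2,\dots\}$ with $\sum_{i=1}^n m_i w_i\le t$. *)

(* Defs.v *)
From mathcomp Require Import all_boot all_order all_algebra.

Set Implicit Arguments.
Unset Strict Implicit.
Unset Printing Implicit Defensive.

Import Order.TTheory GRing.Theory Num.Theory.
Local Open Scope ring_scope.

Definition feasible (n : nat) (w : 'I_n -> nat) (t : nat) (m : 'I_n -> nat) :=
  (\sum_i m i * w i <= t)%N.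

Definition profit (R : realFieldType) (n : nat) (p : 'I_n -> R)
    (m : 'I_n -> nat) : R :=
  \sum_i (m i)%:R * p i.

Definition knapsack_max (R : realFieldType) (n : nat) (w : 'I_n -> nat)
    (p : 'I_n -> R) (t : nat) (v : R) : Prop :=
  (exists m, feasible w t m /\ profit p m = v) /\
  (forall m, feasible w t m -> profit p m <= v).

(* Programs run on a word RAM with [b]-bit words, extended with real arithmetic as in the real
  RAM: weights, capacities, counters and addresses are words, profits are
  exact elements of an ordered field [R].  There is no operation from [R] to
  words (no rounding), so [R] influences words only through the outcome of
  comparisons.  A program mentions neither [R] nor [b], and it uses finitely
  many registers; memory is reached by indirect addressing only. *)

Definition reg := nat.

Inductive wop := WAdd | WSub | WMul | WDiv | WMod.
Inductive rop := RAdd | RSub | RMul | RDiv.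

Inductive instr :=
  | WConst (d : reg) (k : nat)
  | WMove (d x : reg)
  | WOp (o : wop) (d x y : reg)
  | WLoad (d a : reg)
  | WStore (a x : reg)
  | RMove (d x : reg)
  | ROp (o : rop) (d x y : reg)
  | RLoad (d a : reg)
  | RStore (a x : reg)
  | ROfWord (d x : reg).

Inductive test :=
  | WLt (x y : reg)
  | WEq (x y : reg)
  | RLt (x y : reg).

Inductive cmd :=
  | Instr (i : instr)
  | Seq (c1 c2 : cmd)
  | If (q : test) (c1 c2 : cmd)
  | While (q : test) (c : cmd).

Record state (R : Type) := State {
  wreg : reg -> nat;
  wmem : nat -> nat;
  rreg : reg -> R;
  rmem : nat -> R
}.

Definition upd (T : Type) (f : nat -> T) (a : nat) (v : T) : nat -> T :=
  fun x => if x == a then v else f x.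

(* Word arithmetic is unsigned and modulo [2 ^ b]. *)
Definition wop_eval (b : nat) (o : wop) (x y : nat) : nat :=
  match o with
  | WAdd => (x + y) %% 2 ^ b
  | WSub => (x + (2 ^ b - y)) %% 2 ^ b
  | WMul => (x * y) %% 2 ^ b
  | WDiv => x %/ y
  | WMod => x %% y
  end%N.

Definition rop_eval (R : realFieldType) (o : rop) (x y : R) : R :=
  match o with
  | RAdd => x + y
  | RSub => x - y
  | RMul => x * y
  | RDiv => x / y
  end.

Definition instr_eval (R : realFieldType) (b : nat) (i : instr) (s : state R) :
    state R :=
  let: State W M X Y := s in
  match i with
  | WConst d k => State (upd W d (k %% 2 ^ b)%N) M X Y
  | WMove d x => State (upd W d (W x)) M X Y
  | WOp o d x y => State (upd W d (wop_eval b o (W x) (W y))) M X Y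
  | WLoad d a => State (upd W d (M (W a))) M X Y
  | WStore a x => State W (upd M (W a) (W x)) X Y
  | RMove d x => State W M (upd X d (X x)) Y
  | ROp o d x y => State W M (upd X d (rop_eval o (X x) (X y))) Y
  | RLoad d a => State W M (upd X d (Y (W a))) Y
  | RStore a x => State W M X (upd Y (W a) (X x))
  | ROfWord d x => State W M (upd X d (W x)%:R) Y
  end.

Definition test_eval (R : realFieldType) (q : test) (s : state R) : bool :=
  match q with
  | WLt x y => (wreg s x < wreg s y)%N
  | WEq x y => wreg s x == wreg s y
  | RLt x y => rreg s x < rreg s y
  end.

(* [exec b c s k s']: started in [s], the program [c] halts in [s'] after [k]
   steps; every instruction and every evaluation of a test is one step. *)
Inductive exec (R : realFieldType) (b : nat) :
    cmd -> state R -> nat -> state R -> Prop :=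
  | ExecInstr i s : exec b (Instr i) s 1%N (instr_eval b i s)
  | ExecSeq c1 c2 s s1 s2 k1 k2 :
      exec b c1 s k1 s1 -> exec b c2 s1 k2 s2 ->
      exec b (Seq c1 c2) s (k1 + k2)%N s2
  | ExecIfT q c1 c2 s s1 k :
      test_eval q s -> exec b c1 s k s1 -> exec b (If q c1 c2) s k.+1 s1
  | ExecIfF q c1 c2 s s1 k :
      ~~ test_eval q s -> exec b c2 s k s1 -> exec b (If q c1 c2) s k.+1 s1
  | ExecWhileT q c s s1 s2 k1 k2 :
      test_eval q s -> exec b c s k1 s1 -> exec b (While q c) s1 k2 s2 ->
      exec b (While q c) s (k1 + k2).+1%N s2
  | ExecWhileF q c s :
      ~~ test_eval q s -> exec b (While q c) s 1%N s.

Definition array (T : Type) (n : nat) (z : T) (f : 'I_n -> T) : nat -> T :=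
  fun a => if insub a is Some i then f i else z.

(* Input: [n] and [t] in word registers 0 and 1, the weights and the profits
   in cells 0, ..., n-1 of the word memory and of the real memory. *)
Definition input (R : realFieldType) (n : nat) (w : 'I_n -> nat)
    (p : 'I_n -> R) (t : nat) : state R :=
  State (upd (upd (fun=> 0) 0 n) 1 t)%N (array 0%N w) (fun=> 0) (array 0 p).

Definition output (R : realFieldType) (s : state R) : R := rreg s 0%N.

Definition max_weight (n : nat) (w : 'I_n -> nat) : nat := (\max_i w i)%N.

(* The binary logarithm, rounded down, in time bounds; it is replaced by 1 at
   1, where the bound n * u * log^2 u would vanish. *)
Definition log (u : nat) : nat := maxn 1 (trunc_log 2 u).

(* The number of binary digits of N > 0. *)
Definition bits (N : nat) : nat := (trunc_log 2 N).+1.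

(* Main.v *)
(** Write u for the maximal weight, L for its number of binary digits.  If a
    solution uses more than 2L distinct items, two subsets of its support have
    the same weight, and exchanging them kills an item without losing profit;
    so some optimal solution has support at most 2L.  Its vector of parities
    then weighs at most [slack] = 2Lu, and m = 2m' + r reduces the optima for
    capacities just below T to those for capacities just below T / 2, at the
    cost of one 0/1 dynamic program over a window of O(Lu) capacities, that is
    O(nuL) steps.  There are only O(L) levels once t = O(Lu^2).  For larger t,
    let a be the weight of an item of best profit-to-weight ratio: every other
    item may be assumed to occur fewer than a times, hence the other items of a
    solution of small support weigh at most [slack] * u, and copies of the best
    item fill the rest. *)

Require Import Defs.
From mathcomp Require Import all_boot all_order all_algebra.
From mathcomp Require Import zify ring lra.

Set Implicit Arguments.
Unset Strict Implicit.
Unset Printing Implicit Defensive.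

Import Order.TTheory GRing.Theory Num.Theory.
Local Open Scope ring_scope.

(** * Solutions of small support *)

Section Solutions.

Variables (R : realFieldType) (n : nat) (w : 'I_n -> nat) (p : 'I_n -> R).
Hypothesis w_gt0 : forall i, (0 < w i)%N.

Local Notation u := (max_weight w).

Definition weight (m : 'I_n -> nat) := (\sum_i m i * w i)%N.

Definition slack : nat := (2 * bits u * u)%N.

Lemma weight_le_max i : (w i <= u)%N.
Proof. exact: leq_bigmax. Qed.

Lemma lt_expn_bits k : (k < 2 ^ bits k)%N.
Proof. exact: trunc_log_ltn. Qed.

Lemma sum_weight_le (A : {set 'I_n}) : (\sum_(i in A) w i <= #|A| * u)%N.
Proof.
rewrite -sum_nat_const; apply: leq_sum => i _; exact: weight_le_max.
Qed.

(** The counting behind the pigeonhole argument. With [L = bits u], split [2 ^ s] as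
    [2 ^ (s - L) * 2 ^ L]: the second factor exceeds [u], and the first exceeds [s] because
    [s < 2 * (s - L)]. *)
Lemma card_mul_max_lt_exp2 s : (2 * bits u < s)%N -> ((s * u).+1 < 2 ^ s)%N.
Proof.
move=> h; have hu := lt_expn_bits u.
have h2 : (s < 2 ^ (s - bits u))%N.
  have := ltn_expl (s - bits u).-1 (isT : (1 < 2)%N).
  have -> : (s - bits u = (s - bits u).-1.+1)%N by lia.
  rewrite expnS /=; lia.
apply: (@leq_trans (2 ^ (s - bits u) * 2 ^ bits u)); last first.
  by rewrite -expnD leq_pexp2l //; lia.
move: h2 hu; nia.
Qed.

(** Pigeonhole: the weight of a subset of [S] lies between 0 and [#|S| * u], and [S] has more
    subsets than there are such values. *)
Lemma equal_weight_subsets (S : {set 'I_n}) :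
  (2 * bits u < #|S|)%N ->
  exists A B : {set 'I_n}, [/\ A \subset S, B \subset S, A != B &
    (\sum_(i in A) w i = \sum_(i in B) w i)%N].
Proof.
move=> hS.
pose f (A : {set 'I_n}) : 'I_(#|S| * u).+1 := inord (\sum_(i in A) w i).
have fE (A : {set _}) : A \subset S -> f A = (\sum_(i in A) w i)%N :> nat.
  move=> sAS; rewrite inordK // ltnS.
  by apply: leq_trans (sum_weight_le A) _; rewrite leq_mul2r subset_leq_card ?orbT.
have /dinjectivePn[A hA [B hB fAB]] : ~~ dinjectiveb f (powerset S).
  apply/negP => /dinjectiveP inj_f.
  have := max_card (f @: powerset S).
  rewrite card_in_imset // card_powerset card_ord.
  by rewrite leqNgt card_mul_max_lt_exp2.
move: hA hB; rewrite !inE => hA /andP[ne_BA hB].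
exists A, B; split=> //; first by rewrite eq_sym.
by rewrite -!fE // fAB.
Qed.

(** Deleting the common part keeps the weights equal. As weights are positive, neither difference is
    empty, so the less profitable one can be named [B]. *)
Lemma disjoint_equal_weight_subsets (S : {set 'I_n}) :
  (2 * bits u < #|S|)%N ->
  exists A B : {set 'I_n}, [/\ A \subset S, B \subset S, [disjoint A & B],
    B != set0 & (\sum_(i in A) w i = \sum_(i in B) w i)%N
    /\ \sum_(i in B) p i <= \sum_(i in A) p i].
Proof.
move=> /equal_weight_subsets[A [B [sAS sBS neAB eqw]]].
pose A' := A :\: B; pose B' := B :\: A.
have eqw' : (\sum_(i in A') w i = \sum_(i in B') w i)%N.
  move: eqw; rewrite (big_setID B) /= [RHS](big_setID A) /= setIC.
  by move/addnI.
have w0 (C D : {set 'I_n}) :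
    (\sum_(i in C) w i = \sum_(i in D) w i)%N -> C != set0 -> D != set0.
  move=> eCD /set0Pn[i iC]; apply/eqP => D0; move: eCD.
  by rewrite D0 big_set0 (bigD1 i) //= => /eqP; rewrite addn_eq0 -leqn0 leqNgt w_gt0.
have ne : A' != set0 /\ B' != set0.
  suff : A' != set0 \/ B' != set0.
    by case=> h; split=> //; [apply: w0 h|apply: w0 h].
  case: (eqVneq A' set0) => [A0|]; last by left.
  case: (eqVneq B' set0) => [B0|]; last by right.
  case/negP: neAB; rewrite eqEsubset.
  by apply/andP; split; rewrite -setD_eq0; apply/eqP.
have sA'S : A' \subset S by apply: subset_trans sAS; apply: subsetDl.
have sB'S : B' \subset S by apply: subset_trans sBS; apply: subsetDl.
have disj : [disjoint A' & B'].
  rewrite -setI_eq0; apply/eqP/setP => i; rewrite !inE.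
  by case: (i \in A); case: (i \in B).
case: (leP (\sum_(i in B') p i) (\sum_(i in A') p i)) => h.
  by exists A', B'; split=> //; case: ne.
exists B', A'; split=> //; first by rewrite disjoint_sym.
  by case: ne.
by split=> //; apply: ltW.
Qed.

(** Let [q] be the least multiplicity on [B]. Trading [q] copies of every item of [B] for [q] copies
    of every item of [A] keeps the weight and removes the minimizing item; nothing enters the
    support, since [A] already lies in it. *)
Lemma swap_subsets m (A B : {set 'I_n}) :
  let supp (m : 'I_n -> nat) := [set i | (0 < m i)%N] in
  A \subset supp m -> B \subset supp m -> [disjoint A & B] -> B != set0 ->
  (\sum_(i in A) w i = \sum_(i in B) w i)%N ->
  \sum_(i in B) p i <= \sum_(i in A) p i ->
  exists m', [/\ weight m' = weight m, profit p m <= profit p m' &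
    supp m' \proper supp m].
Proof.
move=> supp sA sB disj /set0Pn[i0 i0B] eqw lep.
pose j := [arg min_(i < i0 in B) m i].
have [jB jmin] : j \in B /\ (forall i, i \in B -> m j <= m i)%N.
  by rewrite /j; case: arg_minnP.
pose q := m j.
pose m' i := (m i + q * (i \in A) - q * (i \in B))%N.
(* Both sides are free of subtraction, so the identity can be summed against weights and profits. *)
have m'E i : (m' i + q * (i \in B) = m i + q * (i \in A))%N.
  rewrite /m' subnK //; case: (boolP (i \in B)) => [iB|]; last by lia.
  by have := jmin _ iB; rewrite -/q; lia.
exists m'; split.
- apply/eqP; rewrite -(eqn_add2r (q * \sum_(i in B) w i)) -{2}eqw.
  rewrite /weight !big_distrr /=; apply/eqP.
  rewrite [X in (_ + X)%N]big_mkcond [X in _ = (_ + X)%N]big_mkcond /=.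
  rewrite -!big_split /=; apply: eq_bigr => i _.
  have := m'E i; case: (i \in A); case: (i \in B) => /=; nia.
- have : profit p m' + q%:R * \sum_(i in B) p i =
         profit p m + q%:R * \sum_(i in A) p i.
    rewrite /profit !big_distrr /=.
    rewrite [X in (_ + X)]big_mkcond [X in _ = (_ + X)]big_mkcond /=.
    rewrite -!big_split /=; apply: eq_bigr => i _.
    have := congr1 (fun k => k%:R * p i) (m'E i).
    rewrite !natrD !mulrDl.
    by case: (i \in A); case: (i \in B); rewrite ?muln0 ?muln1 ?mul0r.
  have : q%:R * \sum_(i in B) p i <= q%:R * \sum_(i in A) p i.
    by apply: ler_wpM2l.
  lra.
- apply/properP; split.
    apply/subsetP => i; rewrite !inE => h.
    case: (posnP (m i)) => // mi0; move: h; rewrite /m' mi0.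
    case: (boolP (i \in A)) => [/(subsetP sA)|_]; last by lia.
    by rewrite inE mi0.
  exists j; first exact: (subsetP sB).
  rewrite inE -leqNgt /m' jB.
  have -> : (j \in A) = false.
    by apply/negbTE; apply: contraL jB => jA; rewrite (disjointFr disj jA).
  by rewrite /q; lia.
Qed.

(** Exchanges are repeated by induction on the size of the support. *)
Lemma small_support m :
  exists m', [/\ weight m' = weight m, profit p m <= profit p m' &
    (#|[set i | (0 < m' i)%N]| <= 2 * bits u)%N].
Proof.
have [k] := ubnP #|[set i | (0 < m i)%N]|; elim: k m => // k IH m hk.
case: (leqP #|[set i | (0 < m i)%N]| (2 * bits u)) => h; first by exists m.
have [A [B [sA sB dAB B0 [eqw lep]]]] := disjoint_equal_weight_subsets h.
have [m1 [w1 p1 /proper_card c1]] := swap_subsets sA sB dAB B0 eqw lep.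
have [|m2 [w2 p2 c2]] := IH m1; first by lia.
by exists m2; split=> //; [rewrite w2 | apply: le_trans p2].
Qed.

(** * Tables of optima and the two reductions of the capacity *)

Definition achieves (x : nat) (v : R) :=
  exists m, feasible w x m /\ profit p m = v.

Definition dominates (x : nat) (v : R) :=
  forall m, feasible w x m -> profit p m <= v.

(* Entry y of the table at level T is for capacity T - y.  All entries are
   achievable, but only the first [slack + 2] need be optimal: the dynamic
   program ignores what lies beyond the window, which is wide enough for the
   entries read at the next level. *)
Definition good_table (T : nat) (F : nat -> R) :=
  (forall y, y < minn (2 * slack + 2) T.+1 -> achieves (T - y) (F y))%N /\
  (forall y, y < minn (slack + 2) T.+1 -> dominates (T - y) (F y))%N.

(** [z] is the position of capacity [(T - y) %/ 2] in the table of level [T %/ 2]. *)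
Definition doubled (T : nat) (F : nat -> R) (y : nat) : R :=
  let z := (T %/ 2 - (T - y) %/ 2)%N in F z + F z.

(** The 0/1 update for one item. Positions count missing capacity, so spending [wi] moves from [y]
    up to [y + wi]; entries past the window are ignored. *)
Definition add_item (S wi : nat) (pi : R) (F : nat -> R) (y : nat) : R :=
  if (y + wi < S)%N && (F y < F (y + wi)%N + pi) then F (y + wi)%N + pi else F y.

Fixpoint add_items (S : nat) (F : nat -> R) (j : nat) : nat -> R :=
  if j is j'.+1 then
    add_item S (array 0%N w j') (array 0 p j') (add_items S F j')
  else F.

Lemma arrayE (T : Type) (z : T) (f : 'I_n -> T) (i : 'I_n) : array z f i = f i.
Proof. by rewrite /array valK. Qed.

Lemma good_table0 F : F 0%N = 0 -> good_table 0 F.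
Proof.
move=> F0.
have H y : (y < 1)%N -> y = 0%N by lia.
split=> y; rewrite leq_min => /andP[_ /H->].
  exists (fun=> 0%N); split; first by rewrite /feasible big1.
  by rewrite /profit big1 // => i _; rewrite mul0r.
move=> m; rewrite /feasible leqn0 sum_nat_eq0 F0 => /forallP m0.
rewrite /profit big1 // => i _; have := m0 i.
by rewrite muln_eq0 [w i == _]eqn0Ngt w_gt0 orbF => /eqP->; rewrite mul0r.
Qed.

Lemma add_item_ge S wi pi F y : F y <= add_item S wi pi F y.
Proof. by rewrite /add_item; case: ifP => // /andP[_ /ltW]. Qed.

Lemma add_item_ge_shift S wi pi F y : (y + wi < S)%N ->
  F (y + wi)%N + pi <= add_item S wi pi F y.
Proof.
move=> h; rewrite /add_item h /=; case: ifP => // /negbT; by rewrite -leNgt.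
Qed.

(** Induction on [j]: if item [j] belongs to [r], its update compares with the entry at [y + w i],
    which by induction accounts for the rest of [r]. *)
Lemma add_items_ge S F j (r : {set 'I_n}) y :
  (forall i, i \in r -> i < j)%N -> (y + \sum_(i in r) w i < S)%N ->
  F (y + \sum_(i in r) w i)%N + \sum_(i in r) p i <= add_items S F j y.
Proof.
elim: j r y => [|j IH] r y hr hy.
  have -> : r = set0 by apply/setP => i; rewrite inE; apply/negP => /hr.
  by rewrite !big_set0 addn0 addr0.
rewrite /=; case: (boolP [exists i in r, i == j :> nat]); last first.
  move=> /exists_inPn h; apply: le_trans (IH _ _ _ hy) (add_item_ge _ _ _ _ _).
  by move=> i ir; have := hr _ ir; have := h _ ir; lia.
case/exists_inP => i ir /eqP ij; rewrite -ij !arrayE ij.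
move: hy; rewrite !(big_setD1 i ir) /= => hy.
have hy' : (y + w i + \sum_(k in r :\ i) w k < S)%N by rewrite -addnA.
have := IH (r :\ i) (y + w i)%N _ hy'.
have hr' k : k \in r :\ i -> (k < j)%N.
  rewrite !inE => /andP[ki kr]; have := hr _ kr.
  move: ki; rewrite -val_eqE /= => /eqP; lia.
move=> /(_ hr') h.
have lt_S : (y + w i < S)%N by apply: leq_ltn_trans hy'; apply: leq_addr.
apply: le_trans (add_item_ge_shift (p i) (add_items S F j) lt_S).
rewrite addnA; lra.
Qed.

Lemma add_items_achieves T S F j : (S <= T.+1)%N ->
  (forall y, y < S -> achieves (T - y) (F y))%N -> (j <= n)%N ->
  (forall y, y < S -> achieves (T - y) (add_items S F j y))%N.
Proof.
move=> hS hF; elim: j => [|j IH] hj y hy; first exact: hF.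
have {}IH := IH (ltnW hj).
rewrite /= /add_item; case: ifP => [/andP[lt_S _]|_]; last exact: IH.
have [m [fm pm]] := IH _ lt_S.
pose i := Ordinal hj.
have <- : val i = j by [].
move: lt_S fm pm; rewrite -{1 2 3}[j]/(val i) !arrayE => lt_S fm pm.
exists (fun k => m k + (k == i))%N; split.
  rewrite /feasible; under eq_bigr do rewrite mulnDl.
  rewrite big_split /= [X in (_ + X)%N](bigD1 i) //= eqxx mul1n.
  rewrite [X in (_ + (_ + X))%N]big1 ?addn0; last first.
    by move=> k /negbTE->; rewrite mul0n.
  move: fm; rewrite /feasible -!/(weight m); move: (weight m) (w i) lt_S; lia.
rewrite /profit; under eq_bigr do rewrite natrD mulrDl.
rewrite big_split /= [X in _ + X](bigD1 i) //= eqxx mul1r.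
rewrite [X in _ + (_ + X)]big1 ?addr0; last first.
  by move=> k /negbTE->; rewrite mul0r.
by move: pm; rewrite /profit => ->.
Qed.

Lemma weight_halves m :
  weight m = (2 * weight (fun i => m i %/ 2)
              + \sum_(i in [set i | odd (m i)]) w i)%N.
Proof.
rewrite /weight big_distrr /= [X in (_ + X)%N]big_mkcond /= -big_split /=.
apply: eq_bigr => i _; rewrite inE.
have := divn_eq (m i) 2; rewrite modn2; case: (odd _) => /=; nia.
Qed.

Lemma profit_halves m :
  profit p m = profit p (fun i => m i %/ 2)%N + profit p (fun i => m i %/ 2)%N
              + \sum_(i in [set i | odd (m i)]) p i.
Proof.
rewrite /profit [X in _ + X]big_mkcond /= -!big_split /=.
apply: eq_bigr => i _; rewrite inE.
rewrite {1}(divn_eq (m i) 2) modn2 natrD natrM.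
by case: (odd _) => /=; ring.
Qed.

Lemma good_table_double T F : good_table (T %/ 2) F ->
  good_table T (add_items (minn (2 * slack + 2) T.+1) (doubled T F) n).
Proof.
move=> [achF domF]; set S := minn _ _.
(* The index read is at most [y / 2] rounded up, hence at most [slack + 1]: every entry read is
   among the optimal ones. *)
have zlt y : (y < S -> T %/ 2 - (T - y) %/ 2 < minn (slack + 2) (T %/ 2).+1)%N.
  rewrite /S; lia.
have zE y : (y < S -> T %/ 2 - (T %/ 2 - (T - y) %/ 2) = (T - y) %/ 2)%N.
  rewrite /S; lia.
split.
  apply: add_items_achieves => [|y hy|//]; first by rewrite /S; lia.
  have [|m [fm pm]] := achF (T %/ 2 - (T - y) %/ 2)%N.
    by have := zlt _ hy; lia.
  rewrite zE // in fm.
  exists (fun i => 2 * m i)%N; split.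
    rewrite /feasible; under eq_bigr do rewrite -mulnA.
    rewrite -big_distrr /=; move: fm; rewrite /feasible -!/(weight m).
    by move: (weight m); lia.
  rewrite /doubled -pm /profit -big_split /=; apply: eq_bigr => i _.
  by rewrite natrM; ring.
move=> y hy m0 fm0.
have [m [wm lem supp_m]] := small_support m0.
apply: le_trans lem _.
have {m0 fm0 wm} fm : (weight m <= T - y)%N by rewrite wm.
set r := [set i | odd (m i)].
have wr : (\sum_(i in r) w i <= slack)%N.
  apply: leq_trans (sum_weight_le _) _.
  rewrite /slack leq_mul2r; apply/orP; right; apply: leq_trans supp_m.
  by apply: subset_leq_card; apply/subsetP => i; rewrite !inE; exact: odd_gt0.
have wE := weight_halves m.
rewrite -/r in wE.
(* Here the width of the window is used: [y <= slack + 1] and [r] weighs at most [slack], so the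
   position is at most [2 * slack + 1]. It is also at most [T], because [r] fits into [T - y]. *)
have hS : (y + \sum_(i in r) w i < S)%N by rewrite /S; lia.
have key := @add_items_ge S (doubled T F) n r y (fun i _ => ltn_ord i) hS.
apply: le_trans key.
rewrite profit_halves -/r lerD2r /doubled.
suff : profit p (fun i => m i %/ 2)%N <=
  F (T %/ 2 - (T - (y + \sum_(i in r) w i)) %/ 2)%N by move=> ?; apply: lerD.
apply: domF; first exact: zlt.
rewrite zE // /feasible -/(weight _); move: wE fm hS; rewrite /S; clear.
by move: (\sum_(i in r) w i)%N (weight _) (weight m); lia.
Qed.

(** In a solution of small support, trade each group of [a = w i0] copies of another item [i] for
    [w i] copies of [i0]: same weight, no less profit. The other items then weigh at most
    [slack * u], which leaves room for [k] copies of [i0]; these can be split off. *)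
Lemma reduce_capacity (i0 : 'I_n) t k v :
  (forall i, p i * (w i0)%:R <= p i0 * (w i)%:R) ->
  0 <= p i0 -> (slack * u + k * w i0 <= t)%N ->
  knapsack_max w p (t - k * w i0) v ->
  knapsack_max w p t (v + k%:R * p i0).
Proof.
move=> best p0 ht [[m [fm pm]] domv]; split.
  exists (fun i => m i + k * (i == i0))%N; split.
    rewrite /feasible; under eq_bigr do rewrite mulnDl.
    rewrite big_split /= [X in (_ + X)%N](bigD1 i0) //= eqxx muln1.
    rewrite [X in (_ + (_ + X))%N]big1 ?addn0; last first.
      by move=> j /negbTE->; rewrite muln0.
    by move: fm ht; rewrite /feasible -!/(weight m); move: (weight m) (w i0); lia.
  rewrite /profit; under eq_bigr do rewrite natrD mulrDl.
  rewrite big_split /= [X in _ + X](bigD1 i0) //= eqxx muln1.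
  rewrite [X in _ + (_ + X)]big1 ?addr0; last first.
    by move=> j /negbTE->; rewrite muln0 mul0r.
  by move: pm; rewrite /profit => ->.
move=> m0 fm0; have [m1 [wm lem supp_m]] := small_support m0.
apply: le_trans lem _.
have {m0 fm0 wm} fm1 : (weight m1 <= t)%N by rewrite wm.
set a := w i0 in best ht domv *.
have a_gt0 : (0 < a)%N by exact: w_gt0.
(* [q] is the number of copies of [i0] gained by the trades, [rest] the weight of what remains of
   the other items. *)
pose q := (\sum_(i | i != i0) w i * (m1 i %/ a))%N.
pose rest := (\sum_(i | i != i0) (m1 i %% a) * w i)%N.
have restle : (rest <= slack * u)%N.
  (* Only items of the support contribute, each fewer than [a <= u] copies of weight at most [u]. *)
  apply: (@leq_trans (\sum_(i in [set i | (0 < m1 i)%N]) u * u)).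
    rewrite /rest big_mkcond /= [X in (_ <= X)%N]big_mkcond /=.
    apply: leq_sum => i _; rewrite inE; case: ifP => // _.
    case: posnP => [->|_]; first by rewrite mod0n.
    apply: leq_mul; last exact: weight_le_max.
    by apply: leq_trans (ltnW (ltn_pmod _ a_gt0)) (weight_le_max _).
  rewrite sum_nat_const /slack -!mulnA; rewrite [X in (_ <= X)%N]mulnA.
  by rewrite leq_mul2r supp_m orbT.
have w1E : weight m1 = (rest + (m1 i0 + q) * a)%N.
  rewrite /weight (bigD1 i0) //= mulnDl /q big_distrl /= addnCA; congr addn.
  rewrite -big_split /=; apply: eq_bigr => i _.
  by rewrite {1}(divn_eq (m1 i) a); lia.
have p1E : profit p m1 <=
    \sum_(i | i != i0) (m1 i %% a)%:R * p i + (m1 i0 + q)%:R * p i0.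
  rewrite /profit (bigD1 i0) //= natrD mulrDl.
  suff : \sum_(i | i != i0) (m1 i)%:R * p i <=
    \sum_(i | i != i0) (m1 i %% a)%:R * p i + q%:R * p i0 by lra.
  rewrite /q natr_sum big_distrl /= -big_split /=; apply: ler_sum => i _.
  rewrite {1}(divn_eq (m1 i) a) natrD !natrM.
  have : 0 <= (m1 i %/ a)%:R * (p i0 * (w i)%:R - p i * a%:R).
    by apply: mulr_ge0 => //; rewrite subr_ge0.
  lra.
apply: le_trans p1E _.
(* Padding to at least [k] copies of [i0] makes the subtraction [c - k] exact. *)
pose c := maxn (m1 i0 + q) k.
pose m2 i := (if i == i0 then c - k else m1 i %% a)%N.
have wc : (rest + c * a <= t)%N.
  by rewrite /c; case: (leqP (m1 i0 + q) k) => _; lia.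
have -> : \sum_(i | i != i0) (m1 i %% a)%:R * p i =
    profit p m2 - (c - k)%:R * p i0.
  rewrite /profit [in RHS](bigD1 i0) //= {1}/m2 eqxx addrC addrK.
  by apply: eq_bigr => i ne; rewrite /m2 (negbTE ne).
have : profit p m2 <= v.
  apply: domv; rewrite /feasible (bigD1 i0) //= {1}/m2 eqxx.
  have -> : (\sum_(i | i != i0) m2 i * w i = rest)%N.
    by apply: eq_bigr => i ne; rewrite /m2 (negbTE ne).
  rewrite -/a mulnBl; move: wc; rewrite /c; nia.
have : (m1 i0 + q)%:R * p i0 <= c%:R * p i0.
  by apply: ler_wpM2r => //; rewrite ler_nat leq_maxl.
rewrite natrB ?leq_maxr // mulrBl; lra.
Qed.

End Solutions.

(** * Execution with time bounds *)

Arguments upd T f a v x /.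

Local Coercion Instr : instr >-> cmd.
Local Notation "c1 ;; c2" := (Seq c1 c2) (at level 61, right associativity).

Section Runs.

Variables (R : realFieldType) (b : nat).
Implicit Types (s : state R) (Q : state R -> Prop).

(** A total-correctness triple in which [k] only bounds the number of steps, so that bounds may be
    weakened. *)
Definition runs (c : cmd) s (k : nat) Q :=
  exists k' s', [/\ exec b c s k' s', (k' <= k)%N & Q s'].

Lemma runs_weaken c s k1 k2 Q1 Q2 :
  runs c s k1 Q1 -> (k1 <= k2)%N -> (forall s', Q1 s' -> Q2 s') ->
  runs c s k2 Q2.
Proof.
by move=> [k [s' [e le h]]] le2 h2; exists k, s'; split; [|lia|exact: h2].
Qed.

Lemma runs_instr (i : instr) s k Q : Q (instr_eval b i s) -> runs i s k.+1 Q.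
Proof.
by move=> h; exists 1%N, (instr_eval b i s); split=> //; apply: ExecInstr.
Qed.

Lemma runs_seq k1 k2 c1 c2 s Q :
  runs c1 s k1 (fun s1 => runs c2 s1 k2 Q) -> runs (c1 ;; c2) s (k1 + k2) Q.
Proof.
move=> [k [s1 [e1 le1 [k' [s2 [e2 le2 h]]]]]].
by exists (k + k')%N, s2; split=> //; [apply: ExecSeq e1 e2 | lia].
Qed.

Lemma runs_step (i : instr) c s k Q :
  runs c (instr_eval b i s) k Q -> runs (i ;; c) s k.+1 Q.
Proof. by move=> h; apply: (@runs_seq 1 k); apply: runs_instr. Qed.

Lemma runs_if q c1 c2 s k Q :
  (test_eval q s -> runs c1 s k Q) -> (~~ test_eval q s -> runs c2 s k Q) ->
  runs (If q c1 c2) s k.+1 Q.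
Proof.
move=> h1 h2; case: (boolP (test_eval q s)) => hq.
  have [k' [s' [e le h]]] := h1 hq.
  by exists k'.+1, s'; split=> //; apply: ExecIfT.
have [k' [s' [e le h]]] := h2 hq.
by exists k'.+1, s'; split=> //; apply: ExecIfF.
Qed.

(** The invariant is indexed by the number of completed passes. Each of the [N] passes pays one step
    for its test, and the failing test adds the last one. *)
Lemma runs_while (I : nat -> state R -> Prop) N K q c s Q :
  (forall j s, (j < N)%N -> I j s -> test_eval q s /\ runs c s K (I j.+1)) ->
  (forall s, I N s -> ~~ test_eval q s /\ Q s) ->
  I 0%N s -> runs (While q c) s (N * K.+1).+1 Q.
Proof.
move=> step stop.
suff H d j s0 : (j + d = N)%N -> I j s0 -> runs (While q c) s0 (d * K.+1).+1 Q.
  exact: H.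
elim: d j s0 => [|d IH] j s0.
  rewrite addn0 => -> /stop[hq h].
  by exists 1%N, s0; split=> //; apply: ExecWhileF.
move=> jd Ij; have [|hq [k1 [s1 [e1 le1 h1]]]] := step j s0 _ Ij; first lia.
have [|k2 [s2 [e2 le2 h2]]] := IH j.+1 s1 _ h1; first lia.
exists (k1 + k2).+1, s2; split=> //; last by rewrite mulSn; lia.
exact: ExecWhileT e1 e2.
Qed.

Lemma word_sub x y : (y <= x -> x < 2 ^ b -> (x + (2 ^ b - y)) %% 2 ^ b = x - y)%N.
Proof.
move=> le_yx lt_x.
have -> : (x + (2 ^ b - y) = x - y + 2 ^ b)%N by lia.
by rewrite modnDr modn_small //; lia.
Qed.

End Runs.

(** The frame condition: a program piece changes at most the registers in [l]. *)
Definition same_off (T : Type) (l : seq nat) (f g : nat -> T) :=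
  forall r, r \notin l -> f r = g r.

Lemma same_off_refl T l (f : nat -> T) : same_off l f f.
Proof. by []. Qed.

Lemma same_off_upd T l (f g : nat -> T) a v :
  a \in l -> same_off l f g -> same_off l (upd f a v) g.
Proof.
move=> al h r rl /=; case: eqVneq => [ra|_]; last exact: h.
by rewrite ra al in rl.
Qed.

Lemma same_off_trans T l1 l2 (f g h : nat -> T) :
  {subset l1 <= l2} -> same_off l1 f g -> same_off l2 g h -> same_off l2 f h.
Proof.
move=> s12 fg gh r rl; rewrite fg ?gh //.
by apply: contra rl; apply: s12.
Qed.

Ltac same := solve [repeat (apply: same_off_upd; [by []|]);
  first [assumption | exact: same_off_refl]].
Ltac step := apply: runs_step; rewrite /=.
Ltac word := rewrite ?word_sub ?modn_small; try lia.

(** * The program *)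

(* Word registers: 0 = n, 1 = t (later the reduced capacity), 2 = 1,
   3 = u, 4 = weight of the best item, 5 = item counter, 7 = window length,
   8 = 2^level, 9 = T = t / 2^level, 10 = end of the table, 11 and 12 = table
   positions, 13 = number of copies of the best item taken in advance, 14 = 0,
   15 = T of the previous level, 16 = 2, 17 = slack, 18 = 2u.  Real registers: 1 = profit
   of the best item, 5 = profit taken in advance.  The table occupies the real
   memory from cell n on: cell n + y holds the value for capacity T - y. *)

Section Program.

Variables (R : realFieldType) (b n : nat).

(* Ascending y reads entries not yet updated: each item is used at most once. *)
Definition relax_loop : cmd :=
  (While (WLt 12 10)
    (RLoad 3 12 ;; ROp RAdd 3 3 2 ;; RLoad 4 11 ;;
     If (RLt 4 3) (RStore 11 3) (RMove 4 4) ;;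
     WOp WAdd 11 11 2 ;; WOp WAdd 12 12 2))%N.

Lemma run_relax_loop (W M : nat -> nat) (X Y F : nat -> R) S wi pi :
  W 2 = 1%N -> W 11 = n -> W 12 = (n + wi)%N -> W 10 = (n + S)%N ->
  X 2 = pi -> (forall y, (y < S)%N -> Y (n + y)%N = F y) ->
  (n + S + 1 < 2 ^ b)%N ->
  runs b relax_loop (State W M X Y) (S * 8).+1 (fun s =>
    let: State W' M' X' Y' := s in
    [/\ same_off [:: 11; 12] W' W, M' = M, same_off [:: 3; 4] X' X,
        forall a, (a < n)%N -> Y' a = Y a &
        forall y, (y < S)%N -> Y' (n + y)%N = add_item S wi pi F y]).
Proof.
move=> W2 W11 W12 W10 X2 YF hb.
pose I j (s : state R) := let: State W' M' X' Y' := s in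
  [/\ same_off [:: 11; 12] W' W /\ W' 11 = (n + j)%N /\ W' 12 = (n + wi + j)%N,
    M' = M, same_off [:: 3; 4] X' X, forall a, (a < n)%N -> Y' a = Y a &
    forall y, (y < S)%N ->
      Y' (n + y)%N = if (y < j)%N then add_item S wi pi F y else F y].
(* The subtraction is truncated: an item heavier than the window causes no pass at all. *)
apply: (@runs_weaken _ _ _ _ ((S - wi) * 8).+1) (fun s h => h); last by nia.
apply: (@runs_while _ _ I) => [j [W' M' X' Y'] lt_j|[W' M' X' Y']|].
- move=> [[fW [W'11 W'12]] -> fX fY YF'].
  rewrite /= W'12 fW // W10; split; first by lia.
  step; step; step.
  rewrite W'11 W'12 fX // X2.
  have -> : Y' (n + wi + j)%N = F (j + wi)%N.
    rewrite (_ : n + wi + j = n + (j + wi))%N; last by lia.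
    by rewrite YF'; [case: ifP => //; lia|lia].
  have Yj : Y' (n + j)%N = F j by rewrite YF' ?ltnn //; lia.
  rewrite Yj; apply: (@runs_seq _ _ 2 2); apply: runs_if => /= cmp.
    apply: runs_instr; rewrite /= W'11.
    step; rewrite W'11 fW // W2; word.
    apply: runs_instr; rewrite /= W'12 fW // W2; word.
    split; [split; [|split]| | | |] => //=; [same|lia|lia|same| |].
      by move=> a a_n; case: eqP => [?|_]; [lia|exact: fY].
    move=> y yS; rewrite eqn_add2l; case: eqVneq => [->|ne].
      by rewrite ltnS leqnn /add_item cmp andbT; case: ltnP => //; lia.
    by rewrite YF' // (_ : (y < j.+1)%N = (y < j)%N) //; lia.
  apply: runs_instr; rewrite /=.
  step; rewrite W'11 fW // W2; word.
  apply: runs_instr; rewrite /= W'12 fW // W2; word.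
  split; [split; [|split]| | | |] => //=; [same|lia|lia|same|].
  move=> y yS; case: (eqVneq y j) => [->|ne].
    by rewrite Yj ltnS leqnn /add_item (negbTE cmp) andbF.
  by rewrite YF' // (_ : (y < j.+1)%N = (y < j)%N) //; lia.
- move=> [[fW [W'11 W'12]] -> fX fY YF']; split.
    by rewrite /= W'12 fW // W10; lia.
  split=> // y yS; rewrite YF' // ltn_subRL addnC.
  by case: ifP => // h; rewrite /add_item h.
- split=> //; rewrite addn0; split=> //; split=> //.
  by rewrite addn0.
Qed.

(* Entry y is computed from an entry of index at most y, so the table can be
   updated in place from its end. *)
Definition double_loop : cmd :=
  (While (WLt 14 11)
    (WOp WSub 11 11 2 ;; WOp WSub 12 9 11 ;; WOp WDiv 12 12 16 ;;
     WOp WSub 12 15 12 ;; WOp WAdd 12 12 0 ;; RLoad 2 12 ;;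
     ROp RAdd 2 2 2 ;; WOp WAdd 12 11 0 ;; RStore 12 2))%N.

Lemma run_double_loop (W M : nat -> nat) (X Y F : nat -> R) S S0 T :
  W 0 = n -> W 2 = 1%N -> W 9 = T -> W 11 = S -> W 14 = 0%N ->
  W 15 = (T %/ 2)%N -> W 16 = 2 -> (S <= T.+1)%N ->
  (forall y, (y < S)%N -> (T %/ 2 - (T - y) %/ 2 < S0)%N) ->
  (forall y, (y < S0)%N -> Y (n + y)%N = F y) ->
  (n + S + 1 < 2 ^ b)%N -> (T < 2 ^ b)%N ->
  runs b double_loop (State W M X Y) (S * 10).+1 (fun s =>
    let: State W' M' X' Y' := s in
    [/\ same_off [:: 11; 12] W' W, M' = M, same_off [:: 2] X' X,
        forall a, (a < n)%N -> Y' a = Y a &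
        forall y, (y < S)%N -> Y' (n + y)%N = doubled T F y]).
Proof.
move=> W0 W2 W9 W11 W14 W15 W16 ST hz YF hb hT.
pose I j (s : state R) := let: State W' M' X' Y' := s in
  [/\ same_off [:: 11; 12] W' W /\ W' 11 = (S - j)%N,
    M' = M, same_off [:: 2] X' X, forall a, (a < n)%N -> Y' a = Y a &
    forall y, ((y < S - j)%N -> Y' (n + y)%N = Y (n + y)%N) /\
      ((S - j <= y < S)%N -> Y' (n + y)%N = doubled T F y)].
apply: (@runs_while _ _ I) => [j [W' M' X' Y'] lt_j|[W' M' X' Y']|].
- move=> [[fW W'11] -> fX fY YF'].
  rewrite /= W'11 fW // W14; split; first by lia.
  step; rewrite W'11 fW // W2; word.
  set y := (S - j - 1)%N; have yS : (y < S)%N by rewrite /y; lia.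
  have z_le_y : (T %/ 2 - (T - y) %/ 2 <= y)%N by move: yS; clear -ST; lia.
  have hy : (S - j = y.+1)%N by rewrite /y; lia.
  move: y yS z_le_y hy => y yS z_le_y hy.
  step; rewrite fW // W9 word_sub //; last by lia.
  step; rewrite fW // W16.
  step; rewrite fW // W15 word_sub; [|lia|lia].
  step; rewrite fW // W0 modn_small; last by lia.
  step; step; step; rewrite fW // W0 modn_small; last by lia.
  apply: runs_instr; rewrite /= addnC [(y + n)%N]addnC.
  have -> : Y' (n + (T %/ 2 - (T - y) %/ 2))%N = F (T %/ 2 - (T - y) %/ 2)%N.
    by rewrite (proj1 (YF' _)) ?YF ?hz //; lia.
  split; [split| | | |] => //=; [same|lia|same| |].
    by move=> a a_n; case: eqP => [?|_]; [lia|exact: fY].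
  move=> y'; rewrite eqn_add2l; case: eqVneq => [->|ne].
    by split=> [?|_]; [lia|].
  by split=> hy'; apply YF'; lia.
- move=> [[fW W'11] -> fX fY YF']; split.
    by rewrite /= W'11 fW // W14; lia.
  by split=> // y yS; apply YF'; lia.
- by split=> //; [rewrite subn0|move=> y; split=> // ?; lia].
Qed.

Definition items_loop : cmd :=
  (While (WLt 5 0)
    (WLoad 6 5 ;; RLoad 2 5 ;; WMove 11 0 ;; WOp WAdd 12 0 6 ;;
     relax_loop ;; WOp WAdd 5 5 2))%N.

Variables (w : 'I_n -> nat) (p : 'I_n -> R).
Hypothesis w_gt0 : forall i, (0 < w i)%N.

Lemma run_items_loop (W : nat -> nat) (X Y F : nat -> R) S :
  W 0 = n -> W 2 = 1%N -> W 5 = 0%N -> W 10 = (n + S)%N ->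
  (forall a, (a < n)%N -> Y a = array 0 p a) ->
  (forall y, (y < S)%N -> Y (n + y)%N = F y) ->
  (n + S + 1 < 2 ^ b)%N -> (n + max_weight w < 2 ^ b)%N ->
  runs b items_loop (State W (array 0%N w) X Y) (n * (S * 8 + 7)).+1 (fun s =>
    let: State W' M' X' Y' := s in
    [/\ same_off [:: 5; 6; 11; 12] W' W, M' = array 0%N w,
        same_off [:: 2; 3; 4] X' X,
        forall a, (a < n)%N -> Y' a = array 0 p a &
        forall y, (y < S)%N -> Y' (n + y)%N = add_items w p S F n y]).
Proof.
move=> W0 W2 W5 W10 Yp YF hb hu.
pose I j (s : state R) := let: State W' M' X' Y' := s in
  [/\ same_off [:: 5; 6; 11; 12] W' W /\ W' 5 = j, M' = array 0%N w,
      same_off [:: 2; 3; 4] X' X,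
      forall a, (a < n)%N -> Y' a = array 0 p a &
      forall y, (y < S)%N -> Y' (n + y)%N = add_items w p S F j y].
rewrite addnS; apply: (@runs_while _ _ I) => [j [W' M' X' Y'] lt_j|[W' M' X' Y']|].
- move=> [[fW W'5] -> fX fY YF'].
  rewrite /= W'5 fW // W0; split=> //.
  have wj : (array 0%N w j <= max_weight w)%N.
    by rewrite -[j]/(val (Ordinal lt_j)) arrayE weight_le_max.
  apply: (@runs_weaken _ _ _ _ ((S * 8).+1 + 1).+4) (fun s h => h); last by lia.
  step; rewrite W'5; step; rewrite W'5 fY //; step; step.
  rewrite fW // W0 modn_small; last by lia.
  apply: runs_seq.
  eapply runs_weaken.
  - by apply: (run_relax_loop (wi := array 0%N w j) _ _ _ _ _ _ YF' hb);
      rewrite /= ?fW.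
  - by [].
  move=> [W1 M1 X1 Y1] [fW1 -> fX1 fY1 Y1E].
  apply: runs_instr; rewrite /= !fW1 //= W'5 fW // W2 modn_small; last by lia.
  have {}fW1 : same_off [:: 5; 6; 11; 12] W1 W.
    apply: same_off_trans fW1 _; last by same.
    by move=> r; rewrite !inE => /orP[]->; rewrite ?orbT.
  have {}fX1 : same_off [:: 2; 3; 4] X1 X.
    apply: same_off_trans fX1 _; last by same.
    by move=> r; rewrite !inE => /orP[]->; rewrite ?orbT.
  split=> //; first by split; [same|rewrite addn1].
  by move=> a a_n; rewrite fY1 ?fY.
- by move=> [[fW W'5] -> fX fY YF']; split; rewrite //= W'5 fW // W0 ltnn.
- by split.
Qed.

(** Each pass halves the divisor [2 ^ level], so that [T] runs through the binary prefixes of [t].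
    The window is cut to [T + 1] entries while [T] is small. *)
Definition levels_loop : cmd :=
  (While (WLt 2 8)
    (WOp WDiv 8 8 16 ;; WMove 15 9 ;; WOp WDiv 9 1 8 ;; WOp WAdd 10 9 2 ;;
     If (WLt 7 10) (WMove 10 7) (WMove 10 10) ;;
     WMove 11 10 ;; double_loop ;;
     WConst 5 0 ;; WOp WAdd 10 10 0 ;; items_loop))%N.

(** The summands are the doubling loop, the item loop with the two instructions before it, and the
    seven other steps of a pass. *)
Definition level_time S : nat := ((S * 10).+1 + ((n * (S * 8 + 7)).+1).+2 + 7)%N.

Lemma run_levels_loop (W : nat -> nat) (X Y : nat -> R) t L :
  W 0 = n -> W 1 = t -> W 2 = 1%N -> W 7 = (2 * slack w + 2)%N ->
  W 8 = (2 ^ L)%N -> W 9 = 0%N -> W 14 = 0%N -> W 16 = 2 ->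
  (t < 2 ^ L)%N ->
  (forall a, (a < n)%N -> Y a = array 0 p a) -> Y n = 0 ->
  (n + (2 * slack w + 2) + 1 < 2 ^ b)%N -> (n + max_weight w < 2 ^ b)%N ->
  (t + 1 < 2 ^ b)%N ->
  runs b levels_loop (State W (array 0%N w) X Y)
    (L * (level_time (2 * slack w + 2)).+1).+1 (fun s =>
    [/\ wreg s 0 = n, rreg s 5 = X 5 & knapsack_max w p t (rmem s n)]).
Proof.
set E := (2 * slack w + 2)%N.
move=> W0 W1 W2 W7 W8 W9 W14 W16 ltL Yp Yn hE hu ht.
pose I j (s : state R) := let: State W' M' X' Y' := s in
  [/\ same_off [:: 5; 6; 8; 9; 10; 11; 12; 15] W' W /\
      (W' 8 = (2 ^ (L - j))%N /\ W' 9 = (t %/ 2 ^ (L - j))%N),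
      M' = array 0%N w, same_off [:: 2; 3; 4] X' X,
      forall a, (a < n)%N -> Y' a = array 0 p a &
      exists F, good_table w p (W' 9) F /\
        forall y, (y < minn E (W' 9).+1)%N -> Y' (n + y)%N = F y].
apply: (@runs_while _ _ I) => [j [W' M' X' Y'] lt_j|[W' M' X' Y']|].
- move=> [[fW [W'8 W'9]] -> fX fY [F [goodF YF]]].
  have pow2 : (2 ^ (L - j) = 2 ^ (L - j.+1) * 2)%N.
    by rewrite -expnSr; congr (_ ^ _)%N; lia.
  have pow_gt0 : (0 < 2 ^ (L - j.+1))%N by rewrite expn_gt0.
  rewrite /= W'8 fW // W2; split; first by lia.
  set T := (t %/ 2 ^ (L - j.+1))%N.
  (* Nested floors collapse, so the old level is exactly half of the new one, as [good_table_double]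
     requires. *)
  have T2 : W' 9 = (T %/ 2)%N by rewrite W'9 pow2 divnMA.
  have Tt : (T <= t)%N by apply: leq_div.
  set S := minn E T.+1.
  have SE : (S <= E)%N by rewrite /S; lia.
  have ST : (S <= T.+1)%N by rewrite /S; lia.
  rewrite T2 in goodF YF.
  apply: (@runs_weaken _ _ _ _
    (2 + ((S * 10).+1 + (n * (S * 8 + 7)).+1.+2).+1).+4) (fun s h => h); last first.
    by rewrite /level_time; move: SE; clear; nia.
  step; rewrite W'8 fW // W16 pow2 mulnK //; step; step.
  rewrite (fW 1%N) // W1 -/T; step; rewrite (fW 2) // W2 addn1 modn_small; last by lia.
  apply: (@runs_seq _ _ 2).
  apply: (@runs_weaken _ _ _ _ 2 _ (fun s => exists W1, s = State W1 (array 0%N w) X' Y'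
    /\ [/\ same_off [:: 5; 6; 8; 9; 10; 11; 12; 15] W1 W, W1 8 = (2 ^ (L - j.+1))%N,
      W1 9 = T, W1 15 = (T %/ 2)%N & W1 10 = S])) => //.
    apply: runs_if => /=; rewrite fW // W7 => cmp; apply: runs_instr => /=.
      eexists; split; first by [].
      by split=> //=; [same|rewrite fW // W7 /S; lia].
    eexists; split; first by [].
    by split=> //=; [same|rewrite /S; lia].
  move=> _ [{}W'' [-> [fW1 W18 W19 W115 W110]]]; step; apply: runs_seq.
  eapply runs_weaken.
  - apply: (@run_double_loop _ _ _ _ F S (minn E (T %/ 2).+1) T) => //=;
      try (by rewrite fW1); try lia.
  - by [].
  move=> [W3 M3 X3 Y3] [fW3 -> fX3 fY3 Y3E]; step; step.
  rewrite mod0n (fW3 0%N) //= (fW3 10) //= (fW1 0%N) // W0 W110.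
  rewrite modn_small; last by lia.
  eapply runs_weaken.
  - apply: (run_items_loop _ _ _ _ _ _ Y3E _ hu) => //=;
      try (by rewrite fW3 //= fW1); try lia.
    by move=> a a_n; rewrite fY3 ?fY.
  - by [].
  move=> [W4 M4 X4 Y4] [fW4 -> fX4 fY4 Y4E].
  have W49 : W4 9 = T by rewrite fW4 //= fW3.
  split=> //.
  + split; last by rewrite W49 fW4 //= fW3.
    apply: same_off_trans fW4 _; last first.
      apply: same_off_upd => //; apply: same_off_upd => //.
      apply: same_off_trans fW3 _; last by same.
      by move=> r; rewrite !inE => /orP[]->; rewrite ?orbT.
    by move=> r; rewrite !inE => /or4P[]->; rewrite ?orbT.
  + apply: same_off_trans fX4 _ => //; apply: same_off_trans fX3 _ => //.
    by move=> r; rewrite !inE => ->.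
  + exists (add_items w p S (doubled T F) n); rewrite W49; split=> //.
    exact: good_table_double.
- move=> [[fW [W'8 W'9]] _ fX fY [F [[ach dom] YF]]]; split.
    by rewrite /= W'8 fW // W2 subnn.
  rewrite subnn divn1 in W'9; rewrite W'9 in ach dom YF.
  split; [by rewrite /= fW|exact: fX|].
  (* At the last level [T = t], and position 0 stands for the full capacity. *)
  rewrite /= -[n in Y' n]addn0 YF; last by rewrite /E; lia.
  have := ach 0%N; have := dom 0%N; rewrite subn0 => dom0 ach0.
  by split; [apply: ach0|apply: dom0]; rewrite /E; lia.
(* Since [t < 2 ^ L], the loop starts at [T = 0], where the table is the single cell [n]. *)
- split=> //; first by rewrite subn0 divn_small.
  exists (fun=> 0); rewrite W9; split; first exact: good_table0.
  by move=> y hy; rewrite (_ : n + y = n)%N //; move: hy; lia.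
Qed.

(** * Counting binary digits and scanning the items *)

Definition bits_loop (i : instr) : cmd :=
  (While (WLt 14 6) (WOp WDiv 6 6 16 ;; i))%N.

(** Halving [z] down to 0 takes [bits z] passes. The repeated instruction is left general for two
    uses: adding [2 * u] each time yields [slack], doubling yields a power of two above the
    capacity. *)
Lemma run_bits_loop (i : instr) (d : nat) (g : nat -> nat) (W M : nat -> nat)
    (X Y : nat -> R) z :
  W 6 = z -> W 14 = 0%N -> W 16 = 2 -> W d = g 0%N -> (0 < z)%N ->
  d \notin [:: 6; 14; 16] ->
  (forall j W', (j < bits z)%N -> same_off [:: 6; d] W' W -> W' d = g j ->
    instr_eval b i (State W' M X Y) = State (upd W' d (g j.+1)) M X Y) ->
  runs b (bits_loop i) (State W M X Y) (bits z * 3).+1 (fun s =>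
    exists W', s = State W' M X Y /\ same_off [:: 6; d] W' W /\ W' d = g (bits z)).
Proof.
move=> W6 W14 W16 Wd z_gt0; rewrite !inE !negb_or => /and3P[d6 d14 d16] iE.
pose I j (s : state R) := exists W', s = State W' M X Y /\
  [/\ same_off [:: 6; d] W' W, W' 6 = (z %/ 2 ^ j)%N & W' d = g j].
apply: (@runs_while _ _ I) =>
    [j _ lt_j [W' [-> [fW W'6 W'd]]]|_ [W' [-> [fW W'6 W'd]]]|].
- have W'14 : W' 14 = 0%N by rewrite fW // !inE /= eq_sym (negbTE d14).
  have W'16 : W' 16 = 2 by rewrite fW // !inE /= eq_sym (negbTE d16).
  rewrite /= W'6 W'14; split.
    rewrite divn_gt0 ?expn_gt0 //; apply: leq_trans (trunc_logP (isT : 1 < 2)%N z_gt0).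
    by rewrite leq_exp2l.
  apply: runs_step; rewrite [instr_eval _ _ _]/= W'6 W'16; apply: runs_instr.
  have dE : (d == 6) = false by apply/negbTE.
  rewrite (iE j) //; last 2 first.
  + by apply: same_off_upd; rewrite // !inE.
  + by rewrite /= dE.
  exists (upd (upd W' 6 (z %/ 2 ^ j %/ 2))%N d (g j.+1)); split=> //.
  split.
  + apply: same_off_upd; first by rewrite !inE eqxx orbT.
    by apply: same_off_upd; rewrite // !inE.
  + by rewrite /= eq_sym dE -divnMA expnSr.
  + by rewrite /= eqxx.
- have W'14 : W' 14 = 0%N by rewrite fW // !inE /= eq_sym (negbTE d14).
  rewrite /= W'6 W'14 divn_small ?lt_expn_bits //; split=> //.
  by exists W'.
- by exists W; split=> //; split=> //; rewrite expn0 divn1.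
Qed.

(** One pass finds both the largest weight and an item of best profit-to-weight ratio; ratios are
    compared by cross multiplication. *)
Definition scan_loop : cmd :=
  (While (WLt 5 0)
    (WLoad 6 5 ;; RLoad 2 5 ;;
     If (WLt 3 6) (WMove 3 6) (WMove 3 3) ;;
     ROfWord 3 6 ;; ROp RMul 3 1 3 ;; ROfWord 4 4 ;; ROp RMul 4 2 4 ;;
     If (RLt 3 4) (WMove 4 6 ;; RMove 1 2) (WMove 4 4) ;;
     WOp WAdd 5 5 2))%N.

Lemma run_scan_loop (W : nat -> nat) (X : nat -> R) (i1 : 'I_n) :
  W 0 = n -> W 2 = 1%N -> W 3 = 0%N -> W 4 = w i1 -> W 5 = 0%N -> X 1%N = p i1 ->
  (n < 2 ^ b)%N ->
  runs b scan_loop (State W (array 0%N w) X (array 0 p)) (n * 13).+1 (fun s =>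
    exists W' X', s = State W' (array 0%N w) X' (array 0 p) /\
    [/\ same_off [:: 3; 4; 5; 6] W' W, W' 3 = max_weight w &
      exists i0, [/\ W' 4 = w i0, X' 1%N = p i0 &
        forall i, p i * (w i0)%:R <= p i0 * (w i)%:R]]).
Proof.
move=> W0 W2 W3 W4 W5 X1 hn.
pose I j (s : state R) := exists W' X', s = State W' (array 0%N w) X' (array 0 p) /\
  [/\ same_off [:: 3; 4; 5; 6] W' W, W' 5 = j,
      (W' 3 <= max_weight w)%N /\ (forall i : 'I_n, i < j -> w i <= W' 3)%N &
      exists i0, [/\ W' 4 = w i0, X' 1%N = p i0 &
        forall i : 'I_n, (i < j)%N -> p i * (w i0)%:R <= p i0 * (w i)%:R]].
apply: (@runs_while _ _ I).
- move=> j _ lt_j [W' [X' [-> [fW W'5 [W'3u W'3] [i0 [W'4 X'1 best]]]]]].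
  rewrite /= W'5 fW // W0; split=> //.
  pose i := Ordinal lt_j.
  have wE : array 0%N w j = w i by rewrite -[j]/(val i) arrayE.
  have pE : array 0 p j = p i by rewrite -[j]/(val i) arrayE.
  step; rewrite W'5 wE; step; rewrite W'5 pE.
  apply: (@runs_seq _ _ 2 8).
  apply: (@runs_weaken _ _ _ _ 2 _ (fun s => exists W1, s = State W1 (array 0%N w)
     (upd X' 2 (p i)) (array 0 p) /\ [/\ same_off [:: 3; 4; 5; 6] W1 W, W1 5 = j,
     W1 6 = w i, W1 4 = w i0 & (W1 3 <= max_weight w)%N /\
       (forall i : 'I_n, i < j.+1 -> w i <= W1 3)%N])) => //.
    have eq_i (k : 'I_n) : (k < j.+1)%N -> (k < j)%N \/ k = i.
      rewrite ltnS leq_eqVlt => /orP[/eqP kj|]; last by left.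
      by right; apply: val_inj.
    apply: runs_if => /= cmp; apply: runs_instr => /=; eexists; split=> //.
    + split=> //=; first by same.
      split; first exact: weight_le_max.
      by move=> k /eq_i[/W'3 le|-> //]; apply: leq_trans le (ltnW cmp).
    + split=> //=; first by same.
      by split=> // k /eq_i[/W'3 //|->]; rewrite leqNgt.
  move=> _ [W1 [-> [fW1 W15 W16 W14 W13]]].
  step; step; step; step; rewrite W16 W14 X'1.
  apply: (@runs_seq _ _ 3 1); apply: runs_if => /= cmp.
    step; apply: runs_instr => /=; apply: runs_instr => /=.
    rewrite W15 (fW1 2) // W2 addn1 modn_small; last by lia.
    do 2 eexists; split; first by [].
    split=> //=; first by same.
    exists i; split=> //= k; rewrite ltnS leq_eqVlt => /orP[/eqP kj|kj].
      by rewrite (_ : k = i) //; apply: val_inj.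
    (* Transitivity of the ratio order through [i0]: each comparison is multiplied by a third
       weight, and the positive factor [(w i0)%:R] cancels. *)
    have wi0 : 0 < (w i0)%:R :> R by rewrite ltr0n.
    rewrite -(ler_pM2r wi0).
    have h1 : p k * (w i0)%:R * (w i)%:R <= p i0 * (w k)%:R * (w i)%:R.
      by apply: ler_wpM2r; rewrite // best.
    have h2 : p i0 * (w i)%:R * (w k)%:R <= p i * (w i0)%:R * (w k)%:R.
      by apply: ler_wpM2r => //; apply: ltW.
    lra.
  apply: runs_instr => /=; apply: runs_instr => /=.
  rewrite W15 (fW1 2) // W2 addn1 modn_small; last by lia.
  do 2 eexists; split; first by [].
  split=> //=; first by same.
  exists i0; split=> //= k; rewrite ltnS leq_eqVlt => /orP[/eqP kj|]; last exact: best.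
  by rewrite (_ : k = i); [rewrite leNgt|apply: val_inj].
- move=> _ [W' [X' [-> [fW W'5 [W'3u W'3] [i0 [W'4 X'1 best]]]]]]; split.
    by rewrite /= W'5 fW // W0 ltnn.
  exists W', X'; split=> //; split=> //.
    apply/eqP; rewrite eqn_leq W'3u /=; apply/bigmax_leqP => i _; exact: W'3.
  by exists i0; split=> // i; apply: best.
- exists W, X; split=> //; split=> //; first by rewrite W3.
  by exists i1.
Qed.

End Program.

(** * The two phases: reduction of the capacity, then the levels *)

Definition preprocess : cmd :=
  (WConst 2 1 ;; WConst 16 2 ;; WLoad 4 14 ;; RLoad 1 14 ;; scan_loop ;;
   WMove 6 3 ;; WOp WAdd 18 3 3 ;; bits_loop (WOp WAdd 17 17 18) ;;
   WOp WAdd 7 17 17 ;; WOp WAdd 7 7 16 ;; WOp WMul 6 17 3 ;;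
   If (WLt 6 1) (WOp WSub 13 1 6 ;; WOp WDiv 13 13 4) (WMove 13 14) ;;
   WOp WMul 12 13 4 ;; WOp WSub 1 1 12 ;; ROfWord 5 13 ;; ROp RMul 5 5 1)%N.

(** Storing 0 in cell [n] sets up the table for [T = 0]. Register 0 still holds [n] at the end, so
    [RLoad 0 0] fetches the optimum for the reduced capacity, to which the profit taken in advance
    is added. *)
Definition solve_reduced : cmd :=
  (WMove 6 1 ;; WMove 8 2 ;; bits_loop (WOp WMul 8 8 16) ;;
   ROfWord 6 14 ;; RStore 0 6 ;; levels_loop ;; RLoad 0 0 ;; ROp RAdd 0 0 5)%N.

(** * Correctness and running time *)

Section Correctness.

Variables (R : realFieldType) (b n : nat) (w : 'I_n -> nat) (p : 'I_n -> R).
Variable t : nat.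
Hypotheses (n_gt0 : (0 < n)%N) (t_gt0 : (0 < t)%N).
Hypotheses (w_gt0 : forall i, (0 < w i)%N) (p_gt0 : forall i, 0 < p i).

Local Notation u := (max_weight w).

(** Leaves room for all words that the program forms, so that its modular operations agree with
    those on natural numbers. *)
Hypothesis word_large :
  (n + 2 * slack w + slack w * u + 2 * u + 2 * t + 5 < 2 ^ b)%N.

Lemma max_weight_gt0 : (0 < u)%N.
Proof.
exact: leq_trans (w_gt0 (Ordinal n_gt0)) (weight_le_max w _).
Qed.

Lemma run_preprocess :
  runs b preprocess (input w p t) (13 * n + 3 * bits u + 30) (fun s =>
    exists W X t', s = State W (array 0%N w) X (array 0 p) /\
    [/\ [/\ W 0 = n, W 1 = t', W 2 = 1%N & W 7 = (2 * slack w + 2)%N],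
        [/\ W 9 = 0%N, W 14 = 0%N & W 16 = 2],
        (0 < t')%N, (t' <= t)%N /\ (t' <= slack w * u + u)%N &
        forall v, knapsack_max w p t' v -> knapsack_max w p t (v + X 5)]).
Proof.
have u_gt0 := max_weight_gt0.
apply: (@runs_weaken _ _ _ _
  ((n * 13).+1 + ((bits u * 3).+1 + (3 + 4).+3).+2).+4) (fun s h => h); last by lia.
rewrite /input; step; rewrite modn_small; last by lia.
step; rewrite modn_small; last by lia.
step; step; apply: runs_seq.
eapply runs_weaken.
- apply: (run_scan_loop (p := p) w_gt0 (i1 := Ordinal n_gt0)) => //=.
  + exact: (arrayE 0%N w (Ordinal n_gt0)).
  + exact: (arrayE 0 p (Ordinal n_gt0)).
  + lia.
- by [].
move=> _ [W [X [-> [fW W3 [i0 [W4 X1 best]]]]]].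
have a_le : (w i0 <= u)%N by exact: weight_le_max.
have a_gt0 := w_gt0 i0.
step; step; rewrite W3 modn_small; last by lia.
apply: runs_seq.
have slackE : (bits u * (u + u) = slack w)%N by rewrite /slack; lia.
eapply runs_weaken.
- apply: (@run_bits_loop _ _ (WOp WAdd 17 17 18)%N 17
    (fun j => j * (u + u))%N _ _ _ _ u) => //=;
    try (by rewrite fW).
  move=> j W' lt_j fW' W'17; rewrite W'17 (fW' 18) //= modn_small ?mulSnr //.
  suff : (j * (u + u) + (u + u) <= slack w)%N by lia.
  by rewrite -slackE; nia.
- by [].
move=> _ [W' [-> [fW' W'17]]]; rewrite slackE in W'17.
step; rewrite W'17 modn_small; last by lia.
step; rewrite (fW' 16) //= (fW 16) //= modn_small; last by lia.
step; rewrite W'17 (fW' 3) //= W3 modn_small; last by lia.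
(* As many copies of the best item as fit while [slack w * u] is held back; less than one more copy
   then remains above that reserve. *)
pose k := (if slack w * u < t then (t - slack w * u) %/ w i0 else 0)%N.
have W'1 : W' 1 = t by rewrite fW' //= fW.
have W'14 : W' 14 = 0%N by rewrite fW' //= fW.
have W'4 : W' 4 = w i0 by rewrite fW' //= W4.
have k_le : (k * w i0 <= t - slack w * u)%N.
  by rewrite /k; case: ltnP => // _; apply: leq_trunc_div.
apply: (@runs_seq _ _ 3 4).
apply: (@runs_weaken _ _ _ _ 3 _ (fun s => exists W1,
  s = State W1 (array 0%N w) X (array 0 p) /\
  [/\ same_off [:: 6; 7; 13] W1 W', W1 7 = (2 * slack w + 2)%N & W1 13 = k])) => //.
  apply: runs_if => /=; rewrite W'1 => cmp.
    step; rewrite W'1 word_sub; [|lia|lia].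
    apply: runs_instr => /=; rewrite W'4; eexists; split=> //.
    by split=> //=; [same|lia|rewrite /k cmp].
  apply: runs_instr => /=; eexists; split=> //.
  by split=> //=; [same|lia|rewrite W'14 /k (negbTE cmp)].
move=> _ [W1 [-> [fW1 W17 W113]]].
step; rewrite W113 (fW1 4) // W'4 modn_small; last by lia.
step; rewrite (fW1 1%N) // W'1 word_sub; [|lia|lia].
step; apply: runs_instr => /=; rewrite W113 X1.
do 3 eexists; split; first by [].
split=> /=.
- by split=> //=; rewrite fW1 // fW' //= fW.
- by split=> //=; rewrite fW1 // fW' //= fW.
(* The reduced capacity is at least the minimum of [t] and [slack w * u], hence positive, as
   counting its digits requires. *)
- have : (0 < slack w * u)%N by rewrite /slack !muln_gt0 u_gt0.
  lia.
- split; first by lia.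
  move: k_le; rewrite /k; case: ltnP => h k_le; last by lia.
  have := ltn_ceil (t - slack w * u) a_gt0; rewrite mulSn; lia.
(* If no copy is taken, [slack w * u] may exceed [t] and [reduce_capacity] does not apply, but then
   the capacity is unchanged. *)
- move=> v hv; case: (posnP k) => [k0|k_gt0].
    by move: hv; rewrite k0 mul0n subn0 mul0r addr0.
  apply: reduce_capacity => //; first exact: ltW.
  suff : (slack w * u <= t)%N by lia.
  rewrite leqNgt; apply/negP => h; move: k_gt0.
  by rewrite /k (_ : (slack w * u < t)%N = false) //; lia.
Qed.

Lemma run_solve_reduced W X t' :
  [/\ W 0 = n, W 1 = t', W 2 = 1%N & W 7 = (2 * slack w + 2)%N] ->
  [/\ W 9 = 0%N, W 14 = 0%N & W 16 = 2] -> (0 < t' <= t)%N ->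
  runs b solve_reduced (State W (array 0%N w) X (array 0 p))
    (bits t' * ((level_time n (2 * slack w + 2)) + 4) + 10) (fun s =>
    exists2 v, knapsack_max w p t' v & output s = v + X 5).
Proof.
move=> [W0 W1 W2 W7] [W9 W14 W16] /andP[t'_gt0 t'_le].
have pow_le j : (j < bits t' -> 2 ^ j <= t')%N.
  move=> hj; apply: leq_trans (trunc_logP (isT : 1 < 2)%N t'_gt0).
  by rewrite leq_exp2l.
apply: (@runs_weaken _ _ _ _ ((bits t' * 3).+1 +
  ((bits t' * (level_time n (2 * slack w + 2)).+1).+1 + 2).+2).+2)
  (fun s h => h); last by lia.
step; step; rewrite W1 W2; apply: runs_seq.
eapply runs_weaken.
- apply: (@run_bits_loop _ _ (WOp WMul 8 8 16)%N 8
    (fun j => 2 ^ j)%N _ _ _ _ t') => //=.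
  move=> j W' lt_j fW' W'8; rewrite W'8 (fW' 16) //= W16 modn_small ?expnSr //.
  by have := pow_le _ lt_j; lia.
- by [].
move=> _ [W' [-> [fW' W'8]]].
step; step; rewrite (fW' 0%N) //= (fW' 14) //= W0 W14.
apply: runs_seq; eapply runs_weaken.
- apply: (@run_levels_loop _ _ _ w p w_gt0 _ _ _ t' (bits t')) => //=;
    try (by rewrite fW'); try lia.
  + exact: lt_expn_bits.
  + by move=> a a_n; case: eqP => //; lia.
  + by rewrite eqxx.
- by [].
move=> [W3 M3 X3 Y3] /= [W30 X35 opt].
step; apply: runs_instr; rewrite /output /= W30 X35.
by exists (Y3 n).
Qed.

(** * Number of levels and total time *)

Lemma bits_le_of_ltn_exp z k : (0 < z)%N -> (z < 2 ^ k)%N -> (bits z <= k)%N.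
Proof.
move=> z_gt0 lt_z; rewrite -(ltn_exp2l _ _ (isT : 1 < 2)%N).
exact: leq_ltn_trans (trunc_logP _ z_gt0) lt_z.
Qed.

(** With [Z = 2 ^ bits u], both [u] and [bits u] are below [Z], so [(2 * bits u * u + 1) * u] is
    bounded by a fixed power of [Z]. *)
Lemma bits_reduced t' : (0 < t')%N -> (t' <= slack w * u + u)%N ->
  (bits t' <= 5 * bits u)%N.
Proof.
move=> t'_gt0 t'_le; apply: bits_le_of_ltn_exp => //; rewrite mulnC expnM.
have hL := ltn_expl (bits u) (isT : 1 < 2)%N.
have hu := lt_expn_bits u.
move: t'_le; rewrite /slack; move: (2 ^ bits u)%N hL hu => Z hL hu t'_le.
have L_gt0 : (0 < bits u)%N by [].
have Z_gt1 : (1 < Z)%N by apply: leq_ltn_trans hL.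
have Lu : (bits u * u <= Z.-1 * Z.-1)%N by apply: leq_mul; lia.
have ZZ : (Z * Z * 2 <= Z * Z * Z)%N by rewrite leq_mul2l Z_gt1 orbT.
have h1 : (2 * bits u * u + 1 <= Z * Z * Z)%N.
  have : (Z.-1 * Z.-1 <= Z.-1 * Z)%N by apply: leq_mul => //; lia.
  have : (Z.-1 * Z = Z * Z - Z)%N by rewrite -subn1 mulnBl mul1n.
  rewrite -mulnA; lia.
apply: (@leq_ltn_trans (Z * Z * Z * u)%N).
  by apply: (@leq_trans ((2 * bits u * u + 1) * u)); [lia|rewrite leq_mul2r h1 orbT].
apply: (@leq_trans (Z * Z * Z * (Z * 1))).
  by rewrite muln1 ltn_pmul2l // !muln_gt0; lia.
rewrite !expnS expn0 !mulnA !muln1 leq_pmulr //; lia.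
Qed.

Lemma time_bound k : (k <= 5 * bits u)%N ->
  (13 * n + 3 * bits u + 30 + (k * (level_time n (2 * slack w + 2) + 4) + 10)
   <= 3000 * (n * u * log u ^ 2))%N.
Proof.
move=> hk; have u_gt0 := max_weight_gt0.
have L_gt0 : (0 < bits u)%N by [].
have hL : (bits u <= 2 * log u)%N by rewrite /bits /log; lia.
(* With [x = bits u * u] the window has [4 * x + 2] entries, and the left side is
   [40 * x + 35 + 32 * n * x + 23 * n]; each term is bounded by a multiple of [n * x], and 40 + 35 +
   32 + 23 = 130. *)
have lvl : (level_time n (2 * slack w + 2) + 4 <= 130 * (n * u * bits u))%N.
  rewrite /level_time /slack; move: (bits u) L_gt0 => L L_gt0.
  move: u u_gt0 => v v_gt0.
  have h1 : (1 <= L * v)%N by rewrite muln_gt0 L_gt0.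
  have h2 : (1 <= n * (L * v))%N by rewrite muln_gt0 n_gt0.
  have h3 : (n <= n * (L * v))%N by rewrite leq_pmulr.
  have h4 : (L * v <= n * (L * v))%N by rewrite leq_pmull.
  rewrite -!mulnA [(v * L)%N]mulnC.
  move: (L * v)%N h1 h2 h3 h4 => x h1 h2 h3 h4; lia.
(* 706 = 5 * 130 + 13 + 3 + 40: the levels, the scan of the items, the digit count of [u], and the
   constants. Passing from [bits u] to [log u] costs a factor 4. *)
apply: (@leq_trans (706 * (n * u * bits u ^ 2))).
  have h : (k * (level_time n (2 * slack w + 2) + 4) <=
      5 * bits u * (130 * (n * u * bits u)))%N by apply: leq_mul.
  have h1 : (n <= n * u * bits u ^ 2)%N.
    by rewrite -mulnA leq_pmulr // muln_gt0 u_gt0 expn_gt0 L_gt0.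
  have h2 : (bits u <= n * u * bits u ^ 2)%N.
    by rewrite expnS expn1 mulnCA leq_pmulr // !muln_gt0 n_gt0 u_gt0.
  have h3 : (1 <= n * u * bits u ^ 2)%N.
    by rewrite !muln_gt0 n_gt0 u_gt0.
  have h4 : (5 * bits u * (130 * (n * u * bits u)) = 650 * (n * u * bits u ^ 2))%N.
    by rewrite expnS expn1; lia.
  lia.
have : (n * u * bits u ^ 2 <= n * u * (4 * log u ^ 2))%N.
  rewrite leq_mul2l; apply/orP; right.
  by rewrite (_ : 4 = 2 ^ 2)%N // -expnMn leq_exp2r.
lia.
Qed.

Lemma run_knapsack :
  exists k s, [/\ exec b (preprocess ;; solve_reduced) (input w p t) k s,
    (k <= 3000 * (n * u * log u ^ 2))%N & knapsack_max w p t (output s)].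
Proof.
have [k1 [s1 [exec1 le1]]] := run_preprocess.
move=> [W [X [t' [s1E [hW1 hW2 t'_gt0 [t'_le t'_small] lift]]]]].
have t'P : (0 < t' <= t)%N by rewrite t'_gt0.
have [k2 [s2 [exec2 le2 [v optv outv]]]] := run_solve_reduced X hW1 hW2 t'P.
exists (k1 + k2)%N, s2; split.
- by apply: ExecSeq exec1 _; rewrite s1E.
- apply: leq_trans (time_bound (bits_reduced t'_gt0 t'_small)).
  exact: leq_add.
- by rewrite outv; apply: lift.
Qed.

End Correctness.

(** * Sufficient word length and the theorem *)

Lemma word_size_suffices n (w : 'I_n -> nat) t b : (0 < max_weight w)%N -> (0 < t)%N ->
  (6 * bits (n + max_weight w + t) <= b)%N ->
  (n + 2 * slack w + slack w * max_weight w + 2 * max_weight w + 2 * t + 5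
   < 2 ^ b)%N.
Proof.
move=> u_gt0 t_gt0 hb; set u := max_weight w in u_gt0 hb *.
(* The left side is at most cubic in [Z] with small coefficients, while [2 ^ b] is at least [Z ^ 6];
   as [Z >= 3], the spare factor [Z ^ 3] is at least 27 and absorbs the coefficients. *)
set Z := (n + u + t).+1.
have ZE : (Z ^ 6 <= 2 ^ b)%N.
  apply: leq_trans (leq_pexp2l (isT : 0 < 2)%N hb).
  by rewrite [(6 * _)%N]mulnC expnM leq_exp2r //; apply: lt_expn_bits.
have Lu : (bits u <= u)%N.
  exact: leq_trans (ltn_expl _ _) (trunc_logP _ u_gt0).
apply: leq_trans ZE.
have s_le : (slack w <= 2 * Z * Z)%N.
  rewrite /slack -/u; apply: leq_mul; last by rewrite /Z; lia.
  by rewrite leq_mul2l /=; apply: leq_trans Lu _; rewrite /Z; lia.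
have s_le2 : (slack w * u <= 2 * Z * Z * Z)%N.
  by apply: leq_mul => //; rewrite /Z; lia.
have nut : (n + u + t < Z)%N by [].
have Z3 : (3 <= Z)%N by rewrite /Z; lia.
have Z2 : (9 <= Z * Z)%N by apply: (@leq_mul 3 3).
have Z31 : (Z * Z * 3 <= Z * Z * Z)%N by rewrite leq_mul2l Z3 orbT.
have -> : (Z ^ 6 = (Z * Z * Z) * (Z * Z * Z))%N by rewrite !expnS expn0; lia.
have Z6 : (27 * (Z * Z * Z) <= (Z * Z * Z) * (Z * Z * Z))%N.
  by rewrite leq_mul2r; apply/orP; right; lia.
have Z1 : (Z * 9 <= Z * Z * Z)%N by rewrite -mulnA leq_mul2l Z2 orbT.
move: s_le s_le2 Z6; rewrite -!mulnA; move: nut Z1 Z2 Z31; rewrite -!mulnA.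
lia.
Qed.

Theorem theorem4 :
  exists (A : cmd) (c C : nat),
  forall (R : realFieldType) (n : nat) (w : 'I_n -> nat) (p : 'I_n -> R)
         (t b : nat),
    (0 < n)%N -> (0 < t)%N ->
    (forall i, (0 < w i)%N) -> (forall i, 0 < p i) ->
    let u := max_weight w in
    (c * bits (n + u + t) <= b)%N ->
    exists (k : nat) (s : state R),
      [/\ exec b A (input w p t) k s,
          (k <= C * (n * u * log u ^ 2))%N &
          knapsack_max w p t (output s)].
Proof.
exists (preprocess ;; solve_reduced), 6%N, 3000%N.
move=> R n w p t b n_gt0 t_gt0 w_gt0 p_gt0 u hb.
apply: run_knapsack => //; apply: word_size_suffices => //.
exact: max_weight_gt0.
Qed.
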